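(* Let $(\mathfrak g,[\,,\,])$ be a finite-dimensional real semisimple Lie algebra. Then every PostLie algebra structure $(\mathfrak g,[\,,\,],\circ)$ whose bracket is the given bracket of $\mathfrak g$ is of the form $x\circ y=[f(x),y]$ for all $x,y\in\mathfrak g$, where $f:\mathfrak g\to\mathfrak g$ is a Rota–Baxter operator of weight $1$.
   Context: A PostLie algebra is a vector space $L$ with bilinear $\circ,[\,,\,]$ satisfying, for all $x,y,z$: $[x,y]=-[y,x]$; $[[x,y],z]+[[z,x],y]+[[y,z],x]=0$; $z\circ(y\circ x)-y\circ(z\circ x)+(y\circ z)\circ x-(z\circ y)\circ x+[y,z]\circ x=0$; $z\circ[x,y]-[z\circ x,y]-[x,z\circ y]=0$. A Rota–Baxter operator of weight $\lambda$ on a Lie algebra $\mathfrak g$ is a linear $f:\mathfrak g\to\mathfrak g$ with $[f(x),f(y)]=f([f(x),y]+[x,f(y)]+\lambda[x,y])$ for all $x,y$. *)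

(* Defs.v *)
From HB Require Import structures.
From mathcomp Require Import all_boot all_order all_algebra.
Set Implicit Arguments. Unset Strict Implicit. Unset Printing Implicit Defensive.
Import Order.TTheory GRing.Theory Num.Theory.
Local Open Scope ring_scope.

Section LieDefs.
Variables (F : fieldType) (V : vectType F).

Definition bilinear_op (m : V -> V -> V) : Prop :=
  (forall a x y z, m (a *: x + y) z = a *: m x z + m y z) /\
  (forall a x y z, m z (a *: x + y) = a *: m z x + m z y).

Definition linear_map (f : V -> V) : Prop :=
  forall a x y, f (a *: x + y) = a *: f x + f y.

Definition is_lie_bracket (br : V -> V -> V) : Prop :=
  [/\ bilinear_op br,
      (forall x y, br x y = - br y x) &
      (forall x y z, br (br x y) z + br (br z x) y + br (br y z) x = 0)].

Definition lie_ideal (br : V -> V -> V) (I : {vspace V}) : Prop :=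
  forall x y, y \in I -> br x y \in I.

Definition derived_sub (br : V -> V -> V) (I : {vspace V}) : {vspace V} :=
  (\sum_(i < \dim I) \sum_(j < \dim I)
      <[br (tnth (vbasis I) i) (tnth (vbasis I) j)]>)%VS.

Definition solvable_sub (br : V -> V -> V) (I : {vspace V}) : Prop :=
  exists n, iter n (derived_sub br) I = 0%VS.

Definition semisimple_lie (br : V -> V -> V) : Prop :=
  is_lie_bracket br /\
  forall I : {vspace V}, lie_ideal br I -> solvable_sub br I -> I = 0%VS.

Definition is_postlie (circ br : V -> V -> V) : Prop :=
  [/\ bilinear_op circ, is_lie_bracket br,
      (forall x y z, circ z (circ y x) - circ y (circ z x)
                     + circ (circ y z) x - circ (circ z y) x + circ (br y z) x = 0) &
     
      (forall x y z, circ z (br x y) - br (circ z x) y - br x (circ z y) = 0)].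

Definition rota_baxter (br : V -> V -> V) (lambda : F) (f : V -> V) : Prop :=
  linear_map f /\
  forall x y, br (f x) (f y) = f (br (f x) y + br x (f y) + lambda *: br x y).

End LieDefs.

(* Main.v *)
(** The last axiom of a PostLie algebra says that every left multiplication
  [circ z] is a derivation of the bracket, so the theorem reduces to the fact
  that derivations of a semisimple algebra are inner: [circ z = ad (f z)], and
  injectivity of [ad] then turns the remaining axiom into the Rota-Baxter
  identity for [f].

  Innerness follows from nondegeneracy of the Killing form, which is obtained
  without Cartan's criterion.  Let [I] be the set of [x] with
  [tr (ad x \o D) = 0] for every derivation [D].  Over the complexification,
  conjugating the eigenvalues of the semisimple part of [ad x] gives a
  derivation [Y] with [tr (ad x \o Y) = \sum `|a_i| ^+ 2]; its real part is a
  real derivation, so [ad x] is nilpotent for [x] in [I].  By Engel's theorem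
  the ideal [I] is solvable, hence zero.  Finally the radical [J] of the Killing
  form satisfies [[J, J] <= I = 0], because
  [tr (ad [u, v] \o D) = tr (ad v \o ad (D u))], so [J] is zero as well. *)
Require Import Defs.
From HB Require Import structures.
From mathcomp Require Import all_boot all_order all_algebra.
From mathcomp Require Import spectral ring complex.
Set Implicit Arguments. Unset Strict Implicit. Unset Printing Implicit Defensive.
Import Order.TTheory GRing.Theory Num.Theory.
Local Open Scope ring_scope.

(** * Polynomials in a square matrix: interpolation, generalized eigenspaces, traces *)

Lemma trig_mxM (R : pzSemiRingType) n (A B : 'M[R]_n) :
  is_trig_mx A -> is_trig_mx B ->
  is_trig_mx (A *m B) /\ forall i, (A *m B) i i = A i i * B i i.
Proof.
move=> /is_trig_mxP tA /is_trig_mxP tB; split.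
  apply/is_trig_mxP => i j lt_ij; rewrite mxE big1 // => k _.
  have [lt_ik|le_ki] := ltnP i k; first by rewrite tA ?mul0r.
  by rewrite tB ?mulr0 // (leq_ltn_trans le_ki).
move=> i; rewrite mxE (bigD1 i) //= big1 ?addr0 // => k.
rewrite neq_ltn => /orP[lt_ki|lt_ik]; last by rewrite tA ?mul0r.
by rewrite tB ?mulr0.
Qed.

Lemma horner_mx_trig (R : comNzRingType) n (A : 'M[R]_n.+1) (p : {poly R}) :
  is_trig_mx A ->
  is_trig_mx (horner_mx A p) /\ forall i, horner_mx A p i i = p.[A i i].
Proof.
move=> tA; elim/poly_ind: p => [|p c [tp pE]].
  by rewrite rmorph0 mx0_is_trig; split=> // i; rewrite mxE horner0.
rewrite rmorphD rmorphM /= horner_mx_X horner_mx_C.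
have [tpA pAE] := trig_mxM tp tA; split.
  apply/is_trig_mxP => i j lt_ij.
  by move/is_trig_mxP: tpA => tpA; rewrite mxE tpA // mxE -val_eqE (ltn_eqF lt_ij) addr0.
by move=> i; rewrite mxE pAE pE !mxE eqxx hornerMXaddC.
Qed.

Lemma coprimep_expXsubC (K : fieldType) (a b : K) m n :
  a != b -> coprimep (('X - a%:P) ^+ m) (('X - b%:P) ^+ n).
Proof.
move=> neq_ab; apply/coprimep_expl/coprimep_expr.
by rewrite coprimep_XsubC2 // subr_eq0 eq_sym.
Qed.

(** Interpolation with multiplicity: evaluated at a matrix, such a [q] acts as the scalar [c a] on
    vectors killed by the [n]-th power of the matrix minus [a]. *)
Lemma poly_chinese (K : fieldType) (c : K -> K) (s : seq K) (n : nat) :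
  exists q : {poly K}, forall a, a \in s -> ('X - a%:P) ^+ n %| q - (c a)%:P.
Proof.
elim: s => [|b s [q qP]]; first by exists 0.
have [sb|nsb] := boolP (b \in s).
  by exists q => a; rewrite inE => /predU1P[->|]; apply: qP.
pose S := \prod_(a <- s) ('X - a%:P) ^+ n.
have cop : coprimep (('X - b%:P) ^+ n) S.
  rewrite /S (@big_morph _ _ _ true andb) ?big_all ?coprimep1 //.
    apply/allP=> a sa; apply: coprimep_expXsubC.
    by apply: contraNneq nsb => ->.
  by move=> p r; rewrite coprimepMr.
have /Bezout_eq1_coprimepP[[u v] /= uvE] := cop.
(* By Bezout, [v * S] is 1 modulo the power of ['X - b%:P] and 0 modulo [S], so the correction
   changes [q] only at [b]. *)
exists (q + ((c b)%:P - q) * v * S) => a; rewrite inE => /predU1P[->|sa].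
  have -> : q + ((c b)%:P - q) * v * S - (c b)%:P
            = (q - (c b)%:P) * u * ('X - b%:P) ^+ n.
    by rewrite -[RHS]mulrA (canRL (addrK _) uvE); ring.
  exact: dvdp_mull.
rewrite addrAC dvdp_addr ?qP // dvdp_mull //.
by rewrite /S (big_rem a) //= dvdp_mulr.
Qed.

(** The generalized eigenspaces span the whole space, so an additive property need only be checked
    on each of them. *)
Lemma geigenspace_ind (C : closedFieldType) n (A : 'M[C]_n.+1)
    (Q : 'rV[C]_n.+1 -> Prop) :
    Q 0 -> (forall u v, Q u -> Q v -> Q (u + v)) ->
    (forall a u, root (char_poly A) a -> (u <= geigenspace A a)%MS -> Q u) ->
  forall u, Q u.
Proof.
move=> Q0 QD Qg u.
have [rs rsE] := closed_field_poly_normal (char_poly A).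
rewrite (monicP (char_poly_monic A)) scale1r in rsE.
have size_rs : size rs = n.+1.
  by apply: succn_inj; rewrite -(size_char_poly A) rsE size_prod_XsubC.
pose s := undup rs.
pose p_ (i : 'I_(size s)) := ('X - (s`_i)%:P) ^+ n.+1 : {poly C}.
(* Every root multiplicity is at most [n.+1], so this uniform exponent suffices for all
   eigenvalues. *)
have dvdA : mxminpoly A %| \prod_i p_ i.
  apply: dvdp_trans (mxminpoly_dvd_char A) _; rewrite rsE.
  rewrite -big_undup_iterop_count /= -/s (big_nth 0) big_mkord.
  apply: (big_ind2 (fun p q : {poly C} => p %| q)) => // [p1 p2 q1 q2|i _].
    exact: dvdp_mul.
  rewrite -[iterop _ _ _ _]/(_ ^+ _) /p_.
  by apply: dvdp_exp2l; rewrite -size_rs count_size.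
have := submx1 u; rewrite -(kermxpoly_min dvdA) kermxpoly_prod; last first.
  move=> i j _ _ neq_ji; apply: coprimep_expXsubC.
  by rewrite nth_uniq ?undup_uniq // eq_sym.
case/sub_sumsmxP => w ->; apply: big_ind => // i _.
apply: (Qg s`_i); last exact: submxMl.
by rewrite rsE root_prod_XsubC -mem_undup mem_nth.
Qed.

(** The [d i] are the diagonal entries of a Schur triangular form; if they all vanish, its
    characteristic polynomial is a pure power and Cayley-Hamilton gives nilpotency. *)
Lemma trace_horner_mx (C : numClosedFieldType) n (A : 'M[C]_n.+1) :
  exists d : 'I_n.+1 -> C,
    [/\ forall i, root (char_poly A) (d i),
        forall p, \tr (horner_mx A p) = \sum_i p.[d i] &
        (forall i, d i = 0) -> A ^+ n.+1 = 0].
Proof.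
have [P /unitarymx_unit uP tP] := Schur A (ltn0Sn n).
have {tP} : is_trig_mx (P *m A *m invmx P) by rewrite -conjumx.
set T := P *m A *m invmx P => tT.
have hT p : horner_mx A p = invmx P *m horner_mx T p *m P.
  by rewrite horner_mx_uconj // !mulmxA mulVmx // mul1mx mulmxKV.
exists (fun i => T i i); split=> [i|p|d0].
- rewrite -root_mxminpoly -(mxminpoly_uconj _ uP) conjumx // root_mxminpoly.
  rewrite char_poly_trig // -(big_map (fun i => T i i) predT (fun x => 'X - x%:P)).
  by rewrite root_prod_XsubC; apply/mapP; exists i; rewrite // mem_index_enum.
- rewrite hT mxtrace_mulC mulmxA mulmxV // mul1mx.
  by apply: eq_bigr => i _; have [_ ->] := horner_mx_trig p tT.
have := Cayley_Hamilton T; rewrite char_poly_trig //.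
under eq_bigr do rewrite d0 subr0.
rewrite prodr_const card_ord => T0; have := hT ('X ^+ n.+1).
by rewrite T0 mulmx0 mul0mx rmorphXn /= horner_mx_X.
Qed.

(* The matrices [T i] encode the bilinear product on row vectors in which
   multiplying [v] on the left by the i-th basis vector gives [v *m T i]. *)
Definition struct_mx (R : pzRingType) n (T : 'I_n -> 'M[R]_n) (u : 'rV[R]_n) :=
  \sum_i u 0 i *: T i.

(** Leibniz rule for [X] acting on row vectors from the right, with the left factor of the product a
    basis vector. *)
Definition mx_derivation (R : pzRingType) n (T : 'I_n -> 'M[R]_n) (X : 'M[R]_n) :=
  forall i, T i *m X = X *m T i + struct_mx T (row i X).

(** * Derivations of an algebra given by structure matrices *)

Section StructMx.
Variables (R : comPzRingType) (n : nat) (T : 'I_n -> 'M[R]_n).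

Lemma struct_mx_is_linear : linear (struct_mx T).
Proof.
move=> a u v; rewrite /struct_mx scaler_sumr -big_split /=.
by apply: eq_bigr => i _; rewrite !mxE scalerDl scalerA.
Qed.

HB.instance Definition _ :=
  GRing.isLinear.Build R 'rV[R]_n 'M[R]_n *:%R (struct_mx T) struct_mx_is_linear.

Lemma struct_mx_delta i : struct_mx T (delta_mx 0 i) = T i.
Proof.
rewrite /struct_mx (bigD1 i) //= mxE !eqxx scale1r big1 ?addr0 // => j neq_ji.
by rewrite mxE (negPf neq_ji) andbF scale0r.
Qed.

Lemma mx_derivationP (X : 'M[R]_n) :
  mx_derivation T X <->
  forall u, struct_mx T u *m X = X *m struct_mx T u + struct_mx T (u *m X).
Proof.
split=> [derX u|derX i]; last by rewrite rowE -struct_mx_delta derX.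
have -> : struct_mx T (u *m X) = \sum_i u 0 i *: struct_mx T (row i X).
  rewrite mulmx_sum_row (linear_sum (struct_mx T)) /=.
  by apply: eq_bigr => i _; rewrite linearZ.
rewrite /struct_mx mulmx_suml mulmx_sumr -big_split; apply: eq_bigr => i _ /=.
by rewrite -scalemxAl derX scalerDr scalemxAr.
Qed.

End StructMx.

Section GeneralizedEigenvectors.
Variables (K : fieldType) (n : nat) (T : 'I_n.+1 -> 'M[K]_n.+1) (X : 'M[K]_n.+1).
Hypothesis derX : mx_derivation T X.

(** By the Leibniz rule, [X - (a + b)%:M] sends the product of [u] and [v] to a sum of two products,
    one with [X - a%:M] applied to [u], the other with [X - b%:M] applied to [v]. Each lowers one
    exponent, whence induction on [p + q]. *)
Lemma struct_mx_geigen a b p q (u v : 'rV_n.+1) :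
    u *m (X - a%:M) ^+ p = 0 -> v *m (X - b%:M) ^+ q = 0 ->
  v *m struct_mx T u *m (X - (a + b)%:M) ^+ (p + q) = 0.
Proof.
have [m] := ubnP (p + q); elim: m => // m IHm in p q u v *.
case: p => [|p] lt_m; first by rewrite mulmx1 => ->; rewrite linear0 mulmx0 mul0mx.
case: q => [|q] in lt_m *; first by rewrite mulmx1 => _ ->; rewrite !mul0mx.
rewrite [in X in X -> _]exprS [in X in _ -> X -> _]exprS -!mulmxE !mulmxA => up vq.
rewrite addnS exprS -mulmxE mulmxA.
have -> : v *m struct_mx T u *m (X - (a + b)%:M) =
    v *m (X - b%:M) *m struct_mx T u + v *m struct_mx T (u *m (X - a%:M)).
  have vuX : v *m struct_mx T u *m X =
      v *m X *m struct_mx T u + v *m struct_mx T (u *m X).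
    by rewrite -mulmxA (mx_derivationP _ _).1 // mulmxDr mulmxA.
  have aSu : struct_mx T (a *: u) = a *: struct_mx T u by rewrite linearZ.
  rewrite !mulmxBr !mul_mx_scalar linearB /= aSu mulmxBl vuX mulmxBr.
  rewrite -scalemxAr -scalemxAl scalerDl opprD.
  by rewrite [- (a *: _) - _]addrC addrACA.
have lt_pq_m : (p.+1 + q < m)%N by rewrite -ltnS -addnS.
rewrite mulmxDl (IHm p.+1 q) ?add0r // ?addSnnS ?IHm // -?addSnnS //.
- by rewrite exprS -mulmxE mulmxA.
- by rewrite exprS -mulmxE mulmxA.
Qed.

End GeneralizedEigenvectors.

Lemma sub_geigenspaceP (K : fieldType) n (A : 'M[K]_n.+1) a (u : 'rV_n.+1) :
  (u <= geigenspace A a)%MS -> u *m (A - a%:M) ^+ n.+1 = 0.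
Proof. by rewrite geigenspaceE => /sub_kermxP. Qed.

(* The semisimple part of a derivation is a derivation, and it remains one
   after its eigenvalues are modified by any additive function. *)
Lemma derivation_replica (C : closedFieldType) n (T : 'I_n.+1 -> 'M[C]_n.+1)
    (X : 'M[C]_n.+1) (f : {additive C -> C}) :
    mx_derivation T X ->
  exists q : {poly C}, (forall a, root (char_poly X) a -> q.[a] = f a) /\
    mx_derivation T (horner_mx X q).
Proof.
move=> derX; have [rs rsE] := closed_field_poly_normal (char_poly X).
rewrite (monicP (char_poly_monic X)) scale1r in rsE.
(* The sums [a + b] are included because products of generalized eigenvectors for [a] and [b] are
   killed by a power of [X - (a + b)%:M], with exponent up to [n.+1 + n.+1]. *)
pose s := rs ++ [seq a + b | a <- rs, b <- rs].
have [q qP] := poly_chinese f s (n.+1 + n.+1).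
have rootE a : root (char_poly X) a = (a \in rs) by rewrite rsE root_prod_XsubC.
exists q; split=> [a|].
  rewrite rootE => rs_a.
  have /qP/dvdpP[r /(congr1 (horner^~ a))] : a \in s by rewrite mem_cat rs_a.
  rewrite !hornerE subrr expr0n /= mulr0 => /eqP.
  by rewrite subr_eq0 => /eqP.
have actE a (u : 'rV_n.+1) : a \in s -> u *m (X - a%:M) ^+ (n.+1 + n.+1) = 0 ->
    u *m horner_mx X q = f a *: u.
  move=> /qP/dvdpP[r qE] uXa; apply/eqP; rewrite -subr_eq0; apply/eqP.
  rewrite -mul_mx_scalar -mulmxBr.
  have -> : horner_mx X q - (f a)%:M = (X - a%:M) ^+ (n.+1 + n.+1) * horner_mx X r.
    by rewrite -(horner_mx_C X) -rmorphB qE mulrC rmorphM rmorphXn rmorphB /=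
               horner_mx_X horner_mx_C.
  by rewrite -mulmxE mulmxA uXa mul0mx.
have actE1 a (u : 'rV_n.+1) : a \in rs -> (u <= geigenspace X a)%MS ->
    u *m horner_mx X q = f a *: u.
  move=> rs_a /sub_geigenspaceP uXa; apply: actE; first by rewrite mem_cat rs_a.
  by rewrite exprD -mulmxE mulmxA uXa mul0mx.
apply/mx_derivationP => u; set Y := horner_mx X q.
(* By bilinearity both factors may be taken in generalized eigenspaces, for [a] and [b]; the
   identity then reads [f (a + b) = f a + f b]. *)
elim/(geigenspace_ind (A := X)): u => [|u v IHu IHv|a u].
- by rewrite mul0mx (linear0 (struct_mx T)) mul0mx mulmx0 addr0.
- by rewrite mulmxDl !(linearD (struct_mx T)) /= mulmxDl IHu IHv mulmxDr addrACA.
rewrite rootE => rs_a uXa; apply/row_matrixP=> i; rewrite !rowE.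
elim/(geigenspace_ind (A := X)): (delta_mx 0 i) => [|v w IHv IHw|b v].
- by rewrite !mul0mx.
- by rewrite !mulmxDl IHv IHw.
rewrite rootE => rs_b vXb; rewrite mulmxDr !mulmxA.
rewrite (actE1 a u) // (actE1 b v) // linearZ /=.
rewrite (actE (a + b)); last 1 first.
- exact: struct_mx_geigen (sub_geigenspaceP uXa) (sub_geigenspaceP vXb).
- by rewrite raddfD -scalemxAl -scalemxAr -scalerDl addrC.
by rewrite mem_cat; apply/orP; right; apply/allpairsP; exists (a, b).
Qed.

Lemma map_mx_derivation (R S : comPzRingType) (f : {rmorphism R -> S}) n
    (T : 'I_n -> 'M[R]_n) (X : 'M[R]_n) :
  mx_derivation T X ->
  mx_derivation (fun i => map_mx f (T i)) (map_mx f X).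
Proof.
move=> derX i; rewrite -!map_mxM derX map_mxD; congr (_ + _).
rewrite /struct_mx (raddf_sum (map_mx f)) /=; apply: eq_bigr => j _.
by rewrite map_mxZ !mxE.
Qed.

(** * Descent from the complexification to the real field *)

Section RealPart.
Variable R : rcfType.
Notation Re := (@complex.Re R).
Notation iota := (real_complex R).

Lemma ReD : {morph Re : x y / x + y}. Proof. by move=> [a b] [c d]. Qed.

Lemma Re_sum I (r : seq I) (P : pred I) (F : I -> R[i]) :
  Re (\sum_(i <- r | P i) F i) = \sum_(i <- r | P i) Re (F i).
Proof. exact: (big_morph _ ReD). Qed.

Lemma ReMl a z : Re (iota a * z) = a * Re z.
Proof. by case: z => x y /=; rewrite mul0r subr0. Qed.

Lemma map_Re_mulmxl m n p (A : 'M[R]_(m, n)) (B : 'M[R[i]]_(n, p)) :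
  map_mx Re (map_mx iota A *m B) = A *m map_mx Re B.
Proof.
apply/matrixP=> i k; rewrite !mxE Re_sum.
by apply: eq_bigr => j _; rewrite !mxE ReMl.
Qed.

Lemma map_Re_mulmxr m n p (B : 'M[R[i]]_(m, n)) (A : 'M[R]_(n, p)) :
  map_mx Re (B *m map_mx iota A) = map_mx Re B *m A.
Proof.
apply/matrixP=> i k; rewrite !mxE Re_sum.
by apply: eq_bigr => j _; rewrite !mxE mulrC ReMl mulrC.
Qed.

(** Over real structure matrices the Leibniz rule is a real-linear condition on [Y], and [Re]
    commutes with products by real matrices. *)
Lemma map_Re_derivation n (T : 'I_n -> 'M[R]_n) (Y : 'M[R[i]]_n) :
  mx_derivation (fun i => map_mx iota (T i)) Y ->
  mx_derivation T (map_mx Re Y).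
Proof.
move=> derY i; rewrite -map_Re_mulmxl derY -map_Re_mulmxr.
apply/matrixP=> j k; rewrite !mxE ReD; congr (_ + _).
rewrite /struct_mx !summxE Re_sum; apply: eq_bigr => l _.
by rewrite !mxE mulrC ReMl mulrC.
Qed.

(* The trace of [X] against its conjugate replica is the sum of the squared
   moduli of its eigenvalues. *)
Lemma derivation_nilpotent n (T : 'I_n.+1 -> 'M[R]_n.+1) (X : 'M[R]_n.+1) :
    mx_derivation T X ->
    (forall D, mx_derivation T D -> \tr (X *m D) = 0) ->
  X ^+ n.+1 = 0.
Proof.
move=> derX trX0; pose XC := map_mx iota X.
have [q [qE derY]] :=
  @derivation_replica R[i] n _ XC Num.conj (map_mx_derivation iota derX).
have [d [rootd trE nilX]] := trace_horner_mx XC.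
suff d0 i : d i = 0.
  apply: (@map_mx_inj _ _ iota); rewrite map_mx0.
  by rewrite rmorphXn /= nilX.
have trXY : \tr (XC *m horner_mx XC q) = \sum_i `|d i| ^+ 2.
  rewrite -{1}(horner_mx_X XC) mulmxE -rmorphM trE.
  by apply: eq_bigr => j _; rewrite hornerM hornerX qE // normCK.
have sum_ge0 : 0 <= \sum_i `|d i| ^+ 2 by apply: sumr_ge0 => j _; rewrite exprn_ge0.
(* The hypothesis only kills the real part of the sum; being nonnegative in [R[i]], the sum has no
   imaginary part. *)
have : \sum_i `|d i| ^+ 2 = 0.
  have := trX0 _ (map_Re_derivation derY).
  rewrite -map_Re_mulmxl /mxtrace; under eq_bigr do rewrite mxE.
  rewrite -Re_sum -/(mxtrace _) trXY; move: sum_ge0; rewrite lecE.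
  by case: (\sum_i _) => x y /= /andP[/eqP-> _] ->.
move/psumr_eq0P => /(_ _ i isT)/eqP; rewrite expf_eq0 normr_eq0 /= => H.
by apply/eqP/H => j _; rewrite exprn_ge0.
Qed.

Lemma derivation_iter0 n (T : 'I_n -> 'M[R]_n) (X : 'M[R]_n) :
    mx_derivation T X ->
    (forall D, mx_derivation T D -> \tr (X *m D) = 0) ->
  forall u : 'rV_n, iter n (mulmx^~ X) u = 0.
Proof.
case: n => [|n] in T X * => dX trX0 u; first by rewrite thinmx0.
have iterE k : iter k (mulmx^~ X) u = u *m X ^+ k.
  by elim: k => [|k IHk]; rewrite ?mulmx1 // iterS IHk exprSr -mulmxE mulmxA.
by rewrite iterE (derivation_nilpotent dX trX0) mulmx0.
Qed.

End RealPart.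

(** * Derived subspaces and solvability *)

Section DerivedSub.
Variables (K : fieldType) (V : vectType K) (br : V -> V -> V).
Hypothesis br_bil : bilinear_op br.

Lemma bilinear_r_linear x : linear (br x).
Proof. by move=> a y z; apply: br_bil.2. Qed.

HB.instance Definition _ x :=
  GRing.isLinear.Build K V V *:%R (br x) (bilinear_r_linear x).

Lemma brDl x y z : br (x + y) z = br x z + br y z.
Proof. by rewrite -[x]scale1r br_bil.1 !scale1r. Qed.

Lemma br0l y : br 0 y = 0.
Proof. by apply: (addrI (br 0 y)); rewrite -brDl !addr0. Qed.

Lemma brZl a x z : br (a *: x) z = a *: br x z.
Proof. by rewrite -[a *: x]addr0 br_bil.1 br0l addr0. Qed.

Lemma br_suml I (r : seq I) (P : pred I) (F : I -> V) z :
  br (\sum_(i <- r | P i) F i) z = \sum_(i <- r | P i) br (F i) z.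
Proof. by apply: (big_morph (br^~ z)) => [x y|]; rewrite ?brDl ?br0l. Qed.

Lemma br_in_derived_sub (I : {vspace V}) x y :
  x \in I -> y \in I -> br x y \in derived_sub br I.
Proof.
move=> Ix Iy; rewrite (coord_vbasis Ix) (coord_vbasis Iy).
rewrite br_suml memv_suml // => i _.
rewrite (linear_sum (br _)) /= memv_suml // => j _.
rewrite linearZ /= memvZ // brZl memvZ //.
rewrite -!tnth_nth memvE; apply: (sumv_sup i) => //; apply: (sumv_sup j) => //.
Qed.

Lemma derived_sub_le (I J : {vspace V}) :
  (forall x y, x \in I -> y \in I -> br x y \in J) -> (derived_sub br I <= J)%VS.
Proof.
move=> IJ; apply/subv_sumP => i _; apply/subv_sumP => j _.
by rewrite -memvE IJ // vbasis_mem // mem_tnth.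
Qed.

Lemma derived_subS (I J : {vspace V}) :
  (I <= J)%VS -> (derived_sub br I <= derived_sub br J)%VS.
Proof.
move=> /subvP sIJ; apply: derived_sub_le => x y /sIJ Jx /sIJ Jy.
exact: br_in_derived_sub.
Qed.

(** After one step, the derived series of [I] stays inside that of [J]. *)
Lemma solvable_sub_extension (I J : {vspace V}) :
    (forall x y, x \in I -> y \in I -> br x y \in J) ->
  solvable_sub br J -> solvable_sub br I.
Proof.
move=> /derived_sub_le sIJ [n nJ]; exists n.+1; rewrite iterSr.
apply/eqP; rewrite -subv0 -nJ.
by elim: n {nJ} => //= n; apply: derived_subS.
Qed.

Lemma solvable_sub0 : solvable_sub br 0%VS.
Proof. by exists 0%N. Qed.

End DerivedSub.

Lemma dimvDline (K : fieldType) (V : vectType K) (A : {vspace V}) z :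
  z \notin A -> \dim (A + <[z]>) = (\dim A).+1.
Proof.
move=> nAz; rewrite dimv_disjoint_sum.
  by rewrite dim_vline addnC; case: eqVneq nAz => [->|]; rewrite ?mem0v.
apply/eqP; rewrite -subv0; apply/subvP => x.
rewrite memv_cap memv0 => /andP[Ax /vlineP[c xE]].
rewrite xE; have [->|c0] := eqVneq c 0; first by rewrite scale0r.
by case/negP: nAz; rewrite -(scalerK c0 z) -xE memvZ.
Qed.

(** * Engel's theorem and solvability of ad-nilpotent subalgebras *)

Section Engel.
Variables (K : numFieldType) (V : vectType K) (br : V -> V -> V).
Hypothesis br_lie : is_lie_bracket br.
Let br_bil : bilinear_op br. Proof. by case: br_lie. Qed.

HB.instance Definition _ x :=
  GRing.isLinear.Build K V V *:%R (br x) (bilinear_r_linear br_bil x).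

Lemma lie_anti x y : br x y = - br y x. Proof. by case: br_lie. Qed.

Lemma lie_jacobi x y z : br x (br y z) = br (br x y) z + br y (br x z).
Proof.
have [_ _ /(_ x y z)] := br_lie.
rewrite [br (br y z) x]lie_anti => /eqP; rewrite subr_eq0 => /eqP <-.
by rewrite [br z x]lie_anti [br (- _) y]lie_anti linearN opprK.
Qed.

Definition stable_under (A W : {vspace V}) :=
  forall x y, x \in A -> y \in W -> br x y \in W.

(* Engel's theorem for the action of [A] on the quotients [W / U]. *)
Definition fixes_quotients (A : {vspace V}) := forall U W : {vspace V},
  (U <= W)%VS -> ~~ (W <= U)%VS -> stable_under A U -> stable_under A W ->
  exists w, [/\ w \in W, w \notin U & forall x, x \in A -> br x w \in U].

(** Take [w] killed by [A] modulo [U]. Since [z] normalizes [A], the iterates of [br z] on [w] are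
    still killed by [A] modulo [U]; the last one outside [U] is killed by [z] as well. *)
Lemma fixes_quotientsD1 (A : {vspace V}) z :
    (exists n, forall w, iter n (br z) w = 0) ->
    (forall x, x \in A -> br x z \in A) ->
  fixes_quotients A -> fixes_quotients (A + <[z]>).
Proof.
move=> [n zn0] Az fixA U W sUW nsWU stU stW.
have sA x : x \in A -> x \in (A + <[z]>)%VS by apply: subvP (addvSl _ _) x.
have sz : z \in (A + <[z]>)%VS by rewrite (subvP (addvSr _ _)) ?memv_line.
have [||w [Ww nUw Aw]] := fixA U W sUW nsWU.
- by move=> x y /sA; apply: stU.
- by move=> x y /sA; apply: stW.
have zW m : iter m (br z) w \in W by elim: m => //= m; apply: stW.
have zA m x : x \in A -> br x (iter m (br z) w) \in U.
  elim: m x => [|m IHm] x Ax /=; first exact: Aw.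
  by rewrite lie_jacobi memvD ?IHm ?Az //; apply: stU => //; apply: IHm.
have exU : exists m, iter m (br z) w \in U by exists n; rewrite zn0 mem0v.
case: (ex_minnP exU) => -[|m] Um minm; first by rewrite Um in nUw.
exists (iter m (br z) w); split=> //.
  by apply/negP => /minm; rewrite ltnn.
move=> x /memv_addP[a Aa [_ /vlineP[c ->] ->]].
by rewrite brDl // brZl // memvD ?memvZ //; apply: zA.
Qed.

Variable H : {vspace V}.
Hypothesis subH : stable_under H H.
Hypothesis nilH : forall x, x \in H -> exists n, forall w, iter n (br x) w = 0.

(** Subalgebras [A] of [H] are built one dimension at a time: the property of [A], applied to the
    quotient [H / A], yields a [z] outside [A] that normalizes [A]. *)
Lemma engel : fixes_quotients H.
Proof.
suff IH d : (d <= \dim H)%N -> exists A : {vspace V},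
    [/\ (A <= H)%VS, \dim A = d, stable_under A A & fixes_quotients A].
  have [A [sAH dA _]] := IH _ (leqnn _).
  by have /eqP -> : A == H by rewrite eqEdim sAH dA leqnn.
elim: d => [_|d IHd lt_dH].
  exists 0%VS; split; rewrite ?sub0v ?dimv0 //.
    by move=> x y /[!memv0] /eqP-> _; rewrite br0l.
  move=> U W _ /subvPn[w Ww nUw] _ _; exists w; split=> // x.
  by rewrite memv0 => /eqP->; rewrite br0l ?mem0v.
have [A [sAH dA stA fixA]] := IHd (ltnW lt_dH).
have [||z [Hz nAz Az]] := fixA A H sAH _ stA.
- by apply: contraL lt_dH => /dimvS; rewrite dA -leqNgt.
- by move=> x y /(subvP sAH); apply: subH.
have fixAz := fixes_quotientsD1 (nilH Hz) Az fixA.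
exists (A + <[z]>)%VS; split=> //.
- by rewrite subv_add sAH -memvE.
- by rewrite dimvDline // dA.
have zA x : x \in A -> br z x \in A by move=> /Az; rewrite lie_anti memvN.
(* Antisymmetry gives this because 2 is invertible. *)
have zz : br z z = 0.
  have /eqP : 2%:R *: br z z = 0 by rewrite scaler_nat mulr2n {1}lie_anti addNr.
  by rewrite scaler_eq0 pnatr_eq0 => /eqP.
move=> x y /memv_addP[a Aa [_ /vlineP[c ->] ->]] /memv_addP[b Ab [_ /vlineP[e ->] ->]].
apply: (subvP (addvSl _ _)).
rewrite brDl // brZl // !linearD !linearZ /=.
rewrite zz !scaler0 addr0; do ![apply: memvD | apply: memvZ].
- exact: stA.
- exact: Az.
- exact: zA.
Qed.

(** Engel's theorem on [H / U] gives a [w] outside [U] with all brackets of [H] and [w] in [U], so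
    adding [w] to [U] preserves solvability. *)
Lemma nil_subalgebra_solvable : solvable_sub br H.
Proof.
suff IH d : (d <= \dim H)%N -> exists U : {vspace V},
    [/\ (U <= H)%VS, \dim U = d, stable_under H U & solvable_sub br U].
  have [A [sAH dA _]] := IH _ (leqnn _).
  by have /eqP -> : A == H by rewrite eqEdim sAH dA leqnn.
elim: d => [_|d IHd lt_dH].
  exists 0%VS; split; rewrite ?sub0v ?dimv0 //; last exact: solvable_sub0.
  by move=> x y _ /[!memv0] /eqP->; rewrite linear0.
have [U [sUH dU stU solU]] := IHd (ltnW lt_dH).
have [|w [Hw nUw Uw]] := engel sUH _ stU subH.
  by apply: contraL lt_dH => /dimvS; rewrite dU -leqNgt.
have sU'H : (U + <[w]> <= H)%VS by rewrite subv_add sUH -memvE.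
have U'U x y : x \in H -> y \in (U + <[w]>)%VS -> br x y \in U.
  move=> Hx /memv_addP[u Uu [_ /vlineP[c ->] ->]].
  by rewrite linearD linearZ memvD ?memvZ //; [apply: stU | apply: Uw].
exists (U + <[w]>)%VS; split=> //.
- by rewrite dimvDline // dU.
- by move=> x y Hx Uy; apply: (subvP (addvSl _ _)); apply: U'U.
by apply: solvable_sub_extension solU => // x y /(subvP sU'H); apply: U'U.
Qed.
End Engel.

Import passmx.

(** * Trace of endomorphisms and the trace form *)

Section EndTrace.
Variables (K : fieldType) (V : vectType K).
Implicit Types f g : 'End(V).
Local Notation e := (vbasis {:V}).

Definition lftr f : K^o := \tr (mxof e e f).

Lemma lftr_is_linear : linear lftr.
Proof. by move=> a f g; rewrite /lftr linearP linearD linearZ. Qed.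
HB.instance Definition _ := GRing.isLinear.Build K 'End(V) K^o *:%R lftr lftr_is_linear.

Lemma lftrC f g : lftr (f \o g)%VF = lftr (g \o f)%VF.
Proof. by rewrite /lftr !(mxof_comp _ _ (vbasisP _)) mxtrace_mulC. Qed.

Variable S : {vspace 'End(V)}.

Definition trform_fun f (s : subvs_of S) : K^o := lftr (f \o vsval s)%VF.

Lemma trform_fun_is_linear f : linear (trform_fun f).
Proof.
by move=> a s t; rewrite /trform_fun linearP comp_lfunDr -comp_lfunZr linearP.
Qed.
HB.instance Definition _ f :=
  GRing.isLinear.Build K (subvs_of S) K^o *:%R (trform_fun f) (trform_fun_is_linear f).

(** The functional that [f] induces on [S] through the trace form; bundling it as a vector of the
    dual of [S] allows dimension counts. *)
Definition trform f : 'Hom(subvs_of S, K^o) := linfun (trform_fun f).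

Lemma trform_is_linear : linear trform.
Proof.
move=> a f g; apply/lfunP=> s; rewrite add_lfunE scale_lfunE !lfunE /= /trform_fun.
by rewrite comp_lfunDl -comp_lfunZl linearP.
Qed.
HB.instance Definition _ := GRing.isLinear.Build K 'End(V) _ *:%R trform trform_is_linear.

Lemma trformE f g (Sg : g \in S) : trform f (vsproj S g) = lftr (f \o g)%VF.
Proof. by rewrite lfunE /= /trform_fun vsprojK. Qed.

Lemma trform0P f : trform f = 0 <-> forall g, g \in S -> lftr (f \o g)%VF = 0.
Proof.
split=> [f0 g Sg|f0]; first by rewrite -trformE // f0 lfunE.
by apply/lfunP => s; rewrite !lfunE; apply/f0/subvsP.
Qed.
End EndTrace.

(** * Derivations, the Killing form, and innerness *)

Section LieDerivations.
Variables (R : rcfType) (V : vectType R) (br : V -> V -> V).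
Hypothesis br_lie : is_lie_bracket br.
Let br_bil : bilinear_op br. Proof. by case: br_lie. Qed.

HB.instance Definition _ x :=
  GRing.isLinear.Build R V V *:%R (br x) (bilinear_r_linear br_bil x).

Definition ad x : 'End(V) := linfun (br x).

Lemma adE x y : ad x y = br x y. Proof. exact: lfunE. Qed.

Lemma ad_is_linear : linear ad.
Proof. by move=> a x y; apply/lfunP=> z; rewrite !lfun_simp; apply: br_bil.1. Qed.
HB.instance Definition _ := GRing.isLinear.Build R V 'End(V) *:%R ad ad_is_linear.

Definition derivation (D : 'End(V)) := forall x, (D \o ad x = ad x \o D + ad (D x))%VF.

Lemma derivation_ad x : derivation (ad x).
Proof.
by move=> y; apply/lfunP=> z; rewrite add_lfunE !comp_lfunE !adE lie_jacobi // addrC.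
Qed.

Lemma ad_br x y : ad (br x y) = ((ad x \o ad y) - (ad y \o ad x))%VF.
Proof. by rewrite (derivation_ad x) adE addrC addKr. Qed.

Lemma derivationB D E : derivation D -> derivation E -> derivation (D - E).
Proof.
move=> dD dE x; rewrite comp_lfunDl comp_lfunNl dD dE comp_lfunDr comp_lfunNr.
rewrite add_lfunE opp_lfunE linearB /=.
by rewrite opprD addrACA.
Qed.

(** The failure of the Leibniz rule, linear in [D] and in [x], so that derivations form the kernel
    of a linear map and hence a subspace. *)
Definition der_defect (D : 'End(V)) x := ((D \o ad x) - (ad x \o D) - ad (D x))%VF.

Lemma der_defect_is_linear D : linear (der_defect D).
Proof.
move=> a x y; rewrite /der_defect !(linearP D) !(linearP ad) /= comp_lfunDr comp_lfunDl.
rewrite -comp_lfunZr -comp_lfunZl !scalerBr !opprD.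
by rewrite [RHS]addrACA; congr (_ + _); rewrite [RHS]addrACA.
Qed.
HB.instance Definition _ D :=
  GRing.isLinear.Build R V 'End(V) *:%R (der_defect D) (der_defect_is_linear D).

Definition der_map D : 'Hom(V, 'End(V)) := linfun (der_defect D).

Lemma der_map_is_linear : linear der_map.
Proof.
move=> a D E; apply/lfunP=> x; rewrite add_lfunE scale_lfunE !lfunE /= /der_defect.
rewrite comp_lfunDl -comp_lfunZl comp_lfunDr -comp_lfunZr.
rewrite add_lfunE scale_lfunE (linearP ad) /=.
rewrite !scalerBr !opprD.
by rewrite [RHS]addrACA; congr (_ + _); rewrite [RHS]addrACA.
Qed.
HB.instance Definition _ :=
  GRing.isLinear.Build R 'End(V) 'Hom(V, 'End(V)) *:%R der_map der_map_is_linear.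

Definition derivations : {vspace 'End(V)} := lker (linfun der_map).

Lemma derivationsP D : D \in derivations <-> derivation D.
Proof.
rewrite memv_ker lfunE /=; split=> [/eqP D0 x|dD].
  have := congr1 (fun f : 'Hom(V, 'End(V)) => f x) D0.
  rewrite !lfunE /= /der_defect => /eqP; rewrite subr_eq0 => /eqP <-.
  by rewrite addrC subrK.
apply/eqP/lfunP=> x; rewrite zero_lfunE lfunE /= /der_defect dD.
by rewrite [X in X - _ - _]addrC addrK subrr.
Qed.

(** Transport to matrices in the basis [e]: the [T i] are the matrices of [ad] on basis vectors, and
    both notions of derivation agree. *)
Lemma nil_derivation X : derivation X ->
    (forall D, derivation D -> lftr (X \o D)%VF = 0) ->
  exists n, forall w, iter n X w = 0.
Proof.
move=> dX trX0; pose e := vbasis {:V}; pose n := \dim {:V}.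
have eb : basis_of {:V} e := vbasisP _.
pose T (i : 'I_n) := mxof e e (ad e`_i).
have TE u : struct_mx T u = mxof e e (ad (vecof e u)).
  rewrite /struct_mx /vecof !linear_sum; apply: eq_bigr => i _.
  by rewrite !linearZ.
have derE D : derivation D <-> mx_derivation T (mxof e e D).
  rewrite mx_derivationP; split=> [dD u|dD x].
    rewrite !TE -!(mxof_comp _ _ eb) dD linearD /=; congr (_ + mxof _ _ (ad _)).
    by rewrite (hom_vecof e eb).
  apply: (can_inj (mxofK eb eb)); rewrite linearD /= !(mxof_comp _ _ eb).
  by have := dD (rVof e x); rewrite !TE -(rVof_app e eb) !rVofK.
pose XM := mxof e e X.
suff nilX u : iter n (mulmx^~ XM) u = 0 :> 'rV_n.
  exists n => w; apply/eqP; rewrite -(rVof_eq0 eb) -(nilX (rVof e w)); apply/eqP.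
  by elim: (n) => //= m <-; rewrite (rVof_app e eb).
have /derE dXM := dX.
have trXM0 D : mx_derivation T D -> \tr (XM *m D) = 0.
  rewrite -(hommxK eb eb D) => /derE dD.
  by rewrite -(mxof_comp _ _ eb) -/(lftr _) lftrC; apply: trX0.
exact: derivation_iter0 dXM trXM0 u.
Qed.

(** Expanding [ad (br y x)] as a commutator and using cyclicity of the trace leaves [ad x] against
    the commutator of [D] and [ad y], which is [ad (D y)]. *)
Lemma tr_ad_br D x y : derivation D ->
  lftr (ad (br y x) \o D)%VF = lftr (ad x \o ad (D y))%VF.
Proof.
move=> dD.
rewrite ad_br comp_lfunDl comp_lfunNl linearB /= -comp_lfunA lftrC -!comp_lfunA.
rewrite -linearB /= -comp_lfunNr -comp_lfunDr.
by rewrite dD addrC addKr.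
Qed.

(** For [S] all derivations this is the ideal [I] of the overview; for [S] the inner ones it is the
    radical [J] of the Killing form. *)
Definition perp (S : {vspace 'End(V)}) := lker (linfun (trform S) \o linfun ad)%VF.

Lemma mem_perp S x : x \in perp S <-> forall D, D \in S -> lftr (ad x \o D)%VF = 0.
Proof.
rewrite memv_ker comp_lfunE !lfunE /=.
by split=> [/eqP/trform0P|/trform0P ->].
Qed.

Lemma perp_ideal (S : {vspace 'End(V)}) :
    (forall D, D \in S -> derivation D) ->
    (forall D y, D \in S -> ad (D y) \in S) ->
  lie_ideal br (perp S).
Proof.
move=> Sder Sad y x /mem_perp Px; apply/mem_perp => D SD.
by rewrite tr_ad_br; [apply/Px/Sad | apply: Sder].
Qed.

Hypothesis br_ss : semisimple_lie br.

Lemma perp_derivations0 : perp derivations = 0%VS.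
Proof.
have idP : lie_ideal br (perp derivations).
  apply: perp_ideal => [D /derivationsP //|D y _].
  exact/derivationsP/derivation_ad.
apply: br_ss.2 => //; apply: nil_subalgebra_solvable => // [x y _|x /mem_perp Px].
  exact: idP.
have [|n nP] := nil_derivation (derivation_ad x).
  by move=> D /derivationsP; apply: Px.
exists n => w; rewrite -(nP w); elim: n {nP} => //= n ->.
by rewrite adE.
Qed.

Local Notation inner := (limg (linfun ad)).

Lemma innerP D : reflect (exists x, D = ad x) (D \in inner).
Proof.
apply: (iffP memv_imgP) => [[x _ ->]|[x ->]]; exists x; rewrite ?memvf ?lfunE //.
Qed.

Lemma killing_nondegenerate : perp inner = 0%VS.
Proof.
apply: br_ss.2.
  apply: perp_ideal => [_ /innerP[x ->]|D y _]; first exact: derivation_ad.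
  by apply/innerP; eexists.
exists 1%N; apply/eqP; rewrite -subv0 /=; apply: derived_sub_le => u v _ /mem_perp Pv.
rewrite -perp_derivations0; apply/mem_perp => D /derivationsP dD.
by rewrite tr_ad_br // Pv //; apply/innerP; eexists.
Qed.

Lemma ad_inj : injective ad.
Proof.
move=> x y /eqP; rewrite -subr_eq0 -linearB => /eqP adxy0; apply/eqP.
rewrite -subr_eq0 -memv0 -killing_nondegenerate; apply/mem_perp => D _.
by rewrite adxy0 comp_lfun0l linear0.
Qed.

Lemma derivation_inner D : derivation D -> exists x, D = ad x.
Proof.
move=> dD; pose F := (linfun (trform inner) \o linfun ad)%VF.
have F0 : lker F == 0%VS by rewrite -[lker F]/(perp inner) killing_nondegenerate.
have ad0 : lker (linfun ad) == 0%VS.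
  by apply/lker0P => x y; rewrite !lfunE; apply: ad_inj.
(* [F] is injective from [V] to the dual of [inner], and both have the same dimension because [ad]
   is injective. Hence the functional of [D] is that of some [ad x]. *)
have FT : limg F = fullv.
  apply/eqP; rewrite eqEdim subvf /= limg_dim_eq ?(eqP F0) ?capv0 //.
  rewrite dimvf -[dim _]/(\dim inner * 1)%N muln1.
  by rewrite limg_dim_eq ?(eqP ad0) ?capv0.
have /memv_imgP[x _] : trform inner D \in limg F by rewrite FT memvf.
rewrite comp_lfunE !lfunE /= => DE; exists x.
have E0 : forall y, lftr ((D - ad x) \o ad y)%VF = 0.
  move=> y; apply: (trform0P inner (D - ad x)).1; first by rewrite linearB /= DE subrr.
  by apply/innerP; exists y.
have dE := derivationB dD (derivation_ad x).
apply/eqP; rewrite -subr_eq0; apply/eqP/lfunP => u; rewrite zero_lfunE.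
apply/eqP; rewrite -memv0 -killing_nondegenerate; apply/mem_perp => _ /innerP[v ->].
(* With [E = D - ad x], cyclicity turns the trace of [ad (E u)] against [ad v] into that of [E]
   against [ad (br u v)], which is zero; so [E u] lies in the radical. *)
have -> : ad ((D - ad x)%R u) = (((D - ad x) \o ad u) - (ad u \o (D - ad x)))%VF.
  by rewrite dE [RHS]addrC addKr.
rewrite comp_lfunDl comp_lfunNl linearB /= -!comp_lfunA [X in _ - X]lftrC -comp_lfunA.
rewrite -linearB /= -comp_lfunNr -comp_lfunDr.
by rewrite -ad_br E0.
Qed.
End LieDerivations.

(** * From PostLie products to Rota-Baxter operators *)

Lemma linfun_linearE (K : fieldType) (U V : vectType K) (g : U -> V) :
  linear g -> linfun g =1 g.
Proof.
move=> lin_g x; pose gl : {linear U -> V} :=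
  HB.pack g (GRing.isLinear.Build K U V *:%R g lin_g).
exact: (lfunE gl).
Qed.

Theorem theorem5p10 (R : rcfType) (V : vectType R) (br : V -> V -> V)
    (hss : semisimple_lie br) (circ : V -> V -> V) (hpl : is_postlie circ br) :
  exists f : V -> V, rota_baxter br 1 f /\ (forall x y, circ x y = br (f x) y).
Proof.
have [circ_bil br_lie circ_rb circ_der] := hpl.
have br_bil : bilinear_op br by case: br_lie.
have circ_linE z : linfun (circ z) =1 circ z.
  exact: linfun_linearE (bilinear_r_linear circ_bil z).
(* [f z] is the preimage under [ad] of left multiplication by [z]; the inverse is genuine on the
   image of [ad], where innerness places [circ z]. *)
pose f z := ((linfun (ad br))^-1)%VF (linfun (circ z)).
have circE z x : circ z x = br (f z) x.
  rewrite -(adE br_lie) -circ_linE; congr (fun_of_lfun _ x).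
  have [|w circ_w] := @derivation_inner _ _ _ br_lie hss (linfun (circ z)).
    move=> u; apply/lfunP => v; rewrite add_lfunE !comp_lfunE !(adE br_lie) !circ_linE.
    apply/eqP; rewrite -subr_eq0 -(circ_der u v z) opprD addrA addrAC.
    by apply/eqP.
  have ad_f : linfun (ad br) (f z) = linfun (circ z).
    rewrite limg_lfunVK // circ_w; apply/memv_imgP; exists w; rewrite ?memvf //.
    by rewrite lfunE.
  by rewrite -ad_f lfunE.
have br_inj x y : br x =1 br y -> x = y.
  move=> eq_xy; apply: (ad_inj br_lie hss); apply/lfunP=> z.
  by rewrite !adE.
exists f; split=> //; split=> [a x y|x y]; apply: br_inj => z.
  by rewrite br_bil.1 -!circE; apply: circ_bil.1.
(* After applying [ad], the right side splits into the three terms of the third PostLie axiom with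
   nested left factors; the Jacobi identity rewrites the left side as the commutator of [circ x] and
   [circ y]. *)
rewrite scale1r -[RHS]circE !(brDl circ_bil) -!circE.
rewrite [br x (f y)](lie_anti br_lie) -circE -scaleN1r (brZl circ_bil) scaleN1r.
have := lie_jacobi br_lie (f x) (f y) z; rewrite -!circE => /(canLR (addrK _)) <-.
have /eqP := circ_rb z x y; rewrite -!addrA [X in X == _]addrA addr_eq0.
by rewrite -[X in X == _]opprB eqr_opp addrA => /eqP.
Qed.
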